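(* Let $x_1,x_2,\ldots$ be iid $\mathrm{Exp}(\theta)$ observations, and let the prior distribution of $\theta$ be the $\mathrm{Exp}(1)$ distribution on $\Theta=(0,\infty)$. Let $\psi_{\theta_0,\theta_1}(n)=\mathbb{E}_{\theta_1}[q_n^{\theta_0}]$. (i) For every $\theta>0$ and $n\geq1$ we have $$\psi_{\theta,\theta}(n)=\frac{\theta^{n-1/2}}{2^{n+1/2}\,n!\,\sqrt{\pi}}\left[(n+\theta)K_{n+1/2}(\theta)+\theta K_{n-1/2}(\theta)\right],$$ where $K_\nu$ denotes the modified Bessel function of the second kind, and for every $\theta_0,\theta_1>0$ with $(\theta_0+\theta_1)/2=\theta$ we have $$\psi_{\theta_0,\theta_1}(n)=\exp(\theta-\theta_0)\,\psi_{\theta,\theta}(n)\left(\frac{\theta_0\theta_1}{\theta^2}\right)^n.$$ (ii) For every $\theta_0,\theta_1>0$ the sequence $\psi_{\theta_0,\theta_1}(n)$ is strictly log-concave for $n\geq1$.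
   Context: $\mathrm{Exp}(\theta)$ has density $\theta e^{-\theta x}$ on $x>0$; the prior density is $e^{-\theta}$ on $(0,\infty)$; $\pi=3.14159\ldots$. For $s_n=(x_1,\ldots,x_n)\in(0,\infty)^n$ let $p_\theta(s_n)=\prod_{i=1}^n\theta e^{-\theta x_i}$ and $p(s_n)=\int_0^\infty p_\theta(s_n)e^{-\theta}\,\mathrm{d}\theta$. The posterior density at $\theta_0$ is $q_n^{\theta_0}(s_n)=p_{\theta_0}(s_n)e^{-\theta_0}/p(s_n)$, and $$\psi_{\theta_0,\theta_1}(n)=\mathbb{E}_{\theta_1}[q_n^{\theta_0}]=\int_{(0,\infty)^n}q_n^{\theta_0}(s_n)\,p_{\theta_1}(s_n)\,\mathrm{d}s_n.$$ A sequence of positive numbers $\psi(n)$, $n\geq1$, is strictly log-concave if $\psi(n)^2>\psi(n-1)\psi(n+1)$ for every $n\geq2$. *)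

(* Defs.v *)
From HB Require Import structures.
From mathcomp Require Import all_boot all_order all_algebra.
From mathcomp Require Import all_classical all_reals all_analysis.

Set Implicit Arguments.
Unset Strict Implicit.
Unset Printing Implicit Defensive.

Import Order.TTheory GRing.Theory Num.Theory.
Import numFieldNormedType.Exports.

Local Open Scope classical_set_scope.
Local Open Scope ring_scope.

(* Lebesgue measure on R^n, carried by [n.-tuple R]: the Dirac mass for n = 0,
   and for n.+1 the image of the product measure on R * R^n under
   (x, s) |-> x :: s.  [measurableTypeR R] is R with its Borel sigma-algebra. *)

Section lebesgue_tuple.
Context {R : realType}.

Definition cons_pair n (p : measurableTypeR R * n.-tuple (measurableTypeR R)) :
  n.+1.-tuple (measurableTypeR R) := [the _.-tuple _ of p.1 :: p.2].

Lemma measurable_cons_pair n : measurable_fun [set: _] (@cons_pair n).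
Proof. exact: measurable_cons. Qed.

Section succ.
Variables (n : nat)
  (m : {sigma_finite_measure set (n.-tuple (measurableTypeR R)) -> \bar R}).

Definition lebesgue_tuple_succ : set (n.+1.-tuple (measurableTypeR R)) -> \bar R :=
  pushforward (@lebesgue_measure R \x m)%E (@cons_pair n).

Let succ0 : lebesgue_tuple_succ set0 = 0%E.
Proof. by rewrite /lebesgue_tuple_succ /pushforward preimage_set0 measure0. Qed.

Let succ_ge0 A : (0 <= lebesgue_tuple_succ A)%E.
Proof. exact: (measure_ge0 (@lebesgue_measure R \x m)%E). Qed.

Let succ_sigma_additive : semi_sigma_additive lebesgue_tuple_succ.
Proof.
move=> F mF tF mUF; rewrite /lebesgue_tuple_succ /pushforward preimage_bigcup.
apply: (measure_semi_sigma_additive (s := (@lebesgue_measure R \x m)%E)).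
- by move=> k; rewrite -[X in measurable X]setTI; exact: measurable_cons_pair.
- apply/trivIsetP => /= i j _ _ ij; rewrite -preimage_setI.
  by move/trivIsetP : tF => /(_ _ _ _ _ ij) ->//; rewrite preimage_set0.
- rewrite -preimage_bigcup -[X in measurable X]setTI.
  exact: measurable_cons_pair.
Qed.

HB.instance Definition _ := isMeasure.Build _ _ _
  lebesgue_tuple_succ succ0 succ_ge0 succ_sigma_additive.

(* [lebesgue_measure \x m] has no inferable sigma-finite instance in the library,
   so the exhausting sequence is rebuilt here. *)
Let succ_sigma_finite : sigma_finite setT lebesgue_tuple_succ.
Proof.
pose g (s : n.+1.-tuple (measurableTypeR R)) :=
  (thead s : measurableTypeR R, [tuple of behead s]).
have mg : measurable_fun [set: _] g.
  apply/measurable_fun_pair; first exact: measurable_tnth.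
  exact: measurable_behead.
have gK : cancel (@cons_pair n) g.
  by move=> [x s]; rewrite /g /cons_pair theadE; congr pair; exact: val_inj.
have /sigma_finiteP[F [TF ndF Foo]] := sigma_finiteT (@lebesgue_measure R).
have /sigma_finiteP[G [TG ndG Goo]] := sigma_finiteT m.
exists (fun k => g @^-1` (F k `*` G k)).
  rewrite -preimage_bigcup -[LHS](preimage_setT g); congr (g @^-1` _).
  rewrite -setXTT TF TG predeqE => -[x y]; split.
    move=> [/= [k _ Fkx] [l _ Gly]]; exists (maxn k l) => //; split.
    - by move: x Fkx; exact/subsetPset/ndF/leq_maxl.
    - by move: y Gly; exact/subsetPset/ndG/leq_maxr.
  by move=> [k _ []/= ? ?]; split; exists k.
move=> k; have [mFk Fkoo] := Foo k; have [mGk Gkoo] := Goo k; split.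
  by rewrite -[X in measurable X]setTI; apply: mg => //; exact: measurableX.
rewrite /lebesgue_tuple_succ /pushforward.
have -> : @cons_pair n @^-1` (g @^-1` (F k `*` G k)) = F k `*` G k.
  by apply: funext => p; exact: (congr1 (F k `*` G k) (gK p)).
by rewrite product_measure1E// lte_mul_pinfty// ge0_fin_numE.
Qed.

HB.instance Definition _ := Measure_isSigmaFinite.Build _ _ _
  lebesgue_tuple_succ succ_sigma_finite.

End succ.

Fixpoint lebesgue_tuple n :
    {sigma_finite_measure set (n.-tuple (measurableTypeR R)) -> \bar R} :=
  if n is n'.+1 then lebesgue_tuple_succ (lebesgue_tuple n')
  else \d_ ([tuple] : 0.-tuple (measurableTypeR R)).

End lebesgue_tuple.

Definition cosh {R : realType} (t : R) : R := (expR t + expR (- t)) / 2.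

(* For every real [nu] and every [x > 0]:
   K_nu(x) = \int_0^oo exp(- x cosh t) cosh(nu t) dt,
   the classical integral form of the modified Bessel function of the second
   kind.  The values at [x <= 0] carry no meaning. *)
Definition besselK {R : realType} (nu x : R) : R :=
  \int[@lebesgue_measure R]_(t in `]0, +oo[) (expR (- x * cosh t) * cosh (nu * t)).

Section exponential_model.
Context {R : realType}.
Implicit Types (theta : R) (n : nat).

Definition prior theta : R := exponential_pdf 1 theta.

Definition likelihood theta n (s : n.-tuple (measurableTypeR R)) : R :=
  \prod_(i < n) exponential_pdf theta (tnth s i).

Definition marginal n (s : n.-tuple (measurableTypeR R)) : R :=
  \int[@lebesgue_measure R]_(theta in `]0, +oo[) (likelihood theta s * prior theta).

Definition posterior theta n (s : n.-tuple (measurableTypeR R)) : R :=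
  likelihood theta s * prior theta / marginal s.

Definition sample_space n : set (n.-tuple (measurableTypeR R)) :=
  [set s | forall i, 0 < (tnth s i : R)].

(* Expected posterior density at [theta0] of a sample of size [n] drawn under
   [theta1].  This is the [fine] part of a Lebesgue integral, so a nonzero value
   also says that the integral is finite. *)
Definition psi (theta0 theta1 : R) n : R :=
  \int[lebesgue_tuple n]_(s in @sample_space n)
    (posterior theta0 s * likelihood theta1 s).

End exponential_model.

Definition strictly_log_concave {R : realType} (u : nat -> R) : Prop :=
  (forall n, (1 <= n)%N -> 0 < u n) /\
  (forall n, (2 <= n)%N -> u n.-1 * u n.+1 < u n ^+ 2).

(* Main.v *)
Require Import Defs.
From mathcomp Require Import all_boot all_order all_algebra.
From mathcomp Require Import all_classical all_reals all_analysis.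
From mathcomp Require Import measurable_realfun ring lra.

(** Everything reduces to Laplace transforms of polynomials,
      laplace c p = \int_0^oo p(x) e^(- c x) dx,
    which are handled algebraically: if r solves c r - r' = p, then
    - r(x) e^(- c x) is a primitive of p(x) e^(- c x), so that
    laplace c p = r(0).

    On the sample space the likelihood depends on the sample only through its
    sum S, the marginal is n! / (1 + S)^(n+1), and the integrand of psi is a
    constant times (1 + S)^(n+1) e^(- c S) with c = theta0 + theta1.  Integrating
    out one observation turns p(S) e^(- c S) into r(S) e^(- c S) with r as
    above, and n such steps amount to the Gamma(n) weight S^(n-1) / (n-1)!
    (integral_sum_tuple, laplace_Xn).  So psi theta0 theta1 n is
      (theta0 theta1)^n e^(- theta0) / n!
        * laplace c (S^(n-1) (1 + S)^(n+1)) / (n-1)!,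
    whose last factor only depends on theta = c / 2.  This already gives the
    second formula of part (i).

    Put w = S (1 + S).  Because w'^2 = 4 w + 1 and w'' = 2, the numbers
    laplace c (w^n) satisfy, up to scaling, the three-term recurrence of the
    Bessel polynomials, and S^(n-1) (1 + S)^(n+1) is a combination of w^n,
    w^(n-1) and (w^n)'.  On the other side, K_(n+1/2) satisfies the same
    recurrence: the integrands of K_(nu+1), K_(nu-1) and K_nu are linked by
    the derivative of e^(- x cosh t) sinh(nu t), and K_(1/2) is a Gaussian
    integral in the variable sinh(t/2) (besselK_primitive_half).  Comparing the two gives
    the first formula (besselK_half, psi_core_besselK).

    For part (ii), psi is a geometric sequence times
      ((n + theta) y_n + theta y_(n-1)) / n!,
    y_n being the Bessel polynomials at 1 / theta.  In terms of the ratio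
    t = theta y_n / y_(n-1), strict log-concavity at n is the positivity of a
    polynomial in n, theta and t, quadratic in t (concavity_gap).  The
    recurrence t_(n+1) = 2 n + 1 + theta^2 / t_n preserves quadratic bounds on
    t_n (bessel_ratio_bounds) that are sharp enough for this positivity
    (concavity_gap_bessel_ratio). *)

Set Implicit Arguments.
Unset Strict Implicit.
Unset Printing Implicit Defensive.

Import Order.TTheory GRing.Theory Num.Theory.
Import numFieldNormedType.Exports.

Local Open Scope classical_set_scope.
Local Open Scope ring_scope.

(** * Laplace transforms of polynomials *)

Section LaplacePoly.
Context {F : numFieldType}.
Implicit Types (p q : {poly F}) (c : F).

(** The inverse of the operator q |-> c q - q' on polynomials, as the (finite)
    Neumann series of differentiation divided by c. *)
Definition deriv_resolvent c p : {poly F} :=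
  \sum_(0 <= k < size p) c^-1 ^+ k.+1 *: p^`(k).

Lemma deriv_resolventK c p : c != 0 ->
  c *: deriv_resolvent c p - (deriv_resolvent c p)^`() = p.
Proof.
move=> c0; rewrite /deriv_resolvent scaler_sumr raddf_sum -sumrB /=.
pose u k := - (c^-1 ^+ k *: p^`(k)).
rewrite (eq_bigr (fun k => u k.+1 - u k)); last first.
  move=> k _; rewrite /u opprK addrC derivZ -derivnS scalerA exprS mulrA mulfV//.
  by rewrite mul1r.
rewrite telescope_sumr// /u derivn_poly0// scaler0 oppr0 sub0r opprK.
by rewrite expr0 scale1r derivn0.
Qed.

(** The operator is injective since differentiation lowers the degree. *)
Lemma deriv_resolvent_unique c p q : c != 0 ->
  c *: q - q^`() = p -> deriv_resolvent c p = q.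
Proof.
move=> c0 qp; apply/eqP; rewrite -subr_eq0; set r := deriv_resolvent c p - q.
have rr : c *: r = r^`().
  apply/eqP; rewrite -subr_eq0 /r scalerBr derivB.
  have -> : c *: deriv_resolvent c p - c *: q - ((deriv_resolvent c p)^`() - q^`())
    = (c *: deriv_resolvent c p - (deriv_resolvent c p)^`()) - (c *: q - q^`()).
    by ring.
  by rewrite deriv_resolventK// qp subrr.
apply: contraT => r0; have := lt_size_deriv r0.
by rewrite -rr size_scale// ltnn.
Qed.

(** The Laplace transform at c of the function p on the half-line; that it is
    this integral is [integral_poly_expR] at u = 0. *)
Definition laplace c p : F := (deriv_resolvent c p).[0].

Lemma laplace_resolvent c q : c != 0 -> laplace c (c *: q - q^`()) = q.[0].
Proof. by move=> c0; rewrite /laplace (deriv_resolvent_unique (q := q)). Qed.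

Lemma laplace_comb c (a b : F) p q : c != 0 ->
  laplace c (a *: p + b *: q) = a * laplace c p + b * laplace c q.
Proof.
move=> c0; rewrite /laplace.
rewrite (deriv_resolvent_unique
  (q := a *: deriv_resolvent c p + b *: deriv_resolvent c q))//.
  by rewrite !hornerE.
rewrite derivD !derivZ -[in RHS](deriv_resolventK p c0).
rewrite -[in RHS](deriv_resolventK q c0).
by rewrite !scalerBr !scalerDr !scalerA ![_ * c]mulrC opprD addrACA.
Qed.

Lemma laplace_scale c (a : F) p : c != 0 -> laplace c (a *: p) = a * laplace c p.
Proof.
by move=> c0; rewrite -[_ *: _]addr0 -(scale0r 0) laplace_comb// mul0r addr0.
Qed.

Lemma laplace_deriv c q : c != 0 -> laplace c q^`() = c * laplace c q - q.[0].
Proof.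
move=> c0; rewrite -(laplace_resolvent q c0).
have := laplace_comb c (-1) q q^`() c0; rewrite scaleN1r mulN1r => ->.
by rewrite opprB addrC subrK.
Qed.

(** The (n + 1)-fold iterate of the resolvent is the convolution with the
    n-th power: one integration by parts per factor 'X. *)
Lemma laplace_Xn c n p : c != 0 ->
  laplace c ('X^n * p) = n`!%:R * (iter n.+1 (deriv_resolvent c) p).[0].
Proof.
move=> c0; rewrite iterS -/(laplace _ _).
elim: n p => [|n IH] p; first by rewrite expr0 !mul1r.
rewrite iterSr factS natrM -mulrA -IH.
have := laplace_resolvent ('X^(n.+1) * deriv_resolvent c p) c0.
rewrite [X in laplace c X](_ : _ =
  1 *: ('X^(n.+1) * p) + (- n.+1%:R) *: ('X^n * deriv_resolvent c p)).
  rewrite laplace_comb// mul1r hornerM hornerXn expr0n mul0r mulNr => /eqP.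
  by rewrite subr_eq0 => /eqP.
move: (deriv_resolventK p c0); move: (deriv_resolvent c p) => r <-.
rewrite derivM derivXn scale1r scaleNr -[n.+1.-1]/n scaler_nat.
by rewrite mulrBr -!scalerAr mulrnAl opprD addrA addrAC.
Qed.

Lemma laplace_Xn1 c n : c != 0 -> laplace c 'X^n = n`!%:R / c ^+ n.+1.
Proof.
move=> c0; have resC (a : F) : deriv_resolvent c a%:P = (a / c)%:P.
  apply: deriv_resolvent_unique => //.
  by rewrite derivC subr0 -mul_polyC -polyCM mulrC divfK.
rewrite -[X in laplace c X]mulr1 laplace_Xn//; congr (_ * _).
have -> m : iter m (deriv_resolvent c) 1 = ((c ^+ m)^-1)%:P; last exact: hornerC.
elim: m => [|m IH]; first by rewrite expr0 invr1.
by rewrite iterS IH resC exprSr invfM mulrC.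
Qed.

(** Nonnegativity of all coefficients is the form of positivity on the
    half-line that is visibly stable under the resolvent. *)
Definition nneg_coef p := forall i, 0 <= p`_i.

Lemma nneg_coef_horner p x : nneg_coef p -> 0 <= x -> 0 <= p.[x].
Proof.
move=> p0 x0; rewrite horner_coef sumr_ge0// => i _.
by rewrite mulr_ge0 ?exprn_ge0.
Qed.

Lemma nneg_coef_resolvent c p :
  0 < c -> nneg_coef p -> nneg_coef (deriv_resolvent c p).
Proof.
move=> c0 p0 i; rewrite coef_sum sumr_ge0// => k _.
rewrite coefZ coef_derivn mulr_ge0 ?mulrn_wge0//.
by rewrite exprn_ge0// invr_ge0 ltW.
Qed.

Lemma nneg_coefXn n : nneg_coef 'X^n.
Proof. by move=> i; rewrite coefXn ler0n. Qed.

Lemma nneg_coefXD1n n : nneg_coef (('X + 1) ^+ n).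
Proof.
elim: n => [|n IH] i; first by rewrite expr0 coef1 ler0n.
by rewrite exprSr mulrDr mulr1 coefD coefMX addr_ge0//; case: ifP.
Qed.

(** * The moments of x (1 + x) and the Bessel polynomials *)

Definition XX1 : {poly F} := 'X * ('X + 1).

Lemma derivXX1 : XX1^`() = 'X *+ 2 + 1.
Proof. by rewrite /XX1 derivM derivX derivD derivX derivC; ring. Qed.

Lemma hornerXX1 n : (XX1 ^+ n.+1).[0] = 0.
Proof. by rewrite horner_exp /XX1 hornerM hornerX mul0r expr0n. Qed.

Definition laplaceXX1 c n := laplace c (XX1 ^+ n).

Lemma laplaceXX1_0 c : c != 0 -> laplaceXX1 c 0 = c^-1.
Proof.
move=> c0; rewrite /laplaceXX1 expr0 -[RHS](hornerC _ 0).
by rewrite -(laplace_resolvent c^-1%:P c0) derivC subr0 -mul_polyC -polyCM mulfV.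
Qed.

Lemma laplaceXX1_1 c : c != 0 -> laplaceXX1 c 1 = c^-1 ^+ 2 + 2 * c^-1 ^+ 3.
Proof.
move=> c0; have e1 : c * laplace c 'X = c^-1.
  rewrite -laplaceXX1_0// /laplaceXX1 expr0 -derivX laplace_deriv//.
  by rewrite hornerX subr0.
have : laplace c XX1^`() = c * laplaceXX1 c 1.
  by rewrite laplace_deriv// -[XX1]expr1 hornerXX1 subr0.
rewrite derivXX1 (_ : 'X *+ 2 + 1 = 2%:R *: 'X + 1 *: (XX1 ^+ 0)); last first.
  by rewrite scaler_nat expr0 scale1r.
rewrite laplace_comb// mul1r -/(laplaceXX1 c 0) laplaceXX1_0// => e2.
apply: (mulfI c0); rewrite -e2; apply: (mulfI c0).
by rewrite mulrDr mulrCA e1; field.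
Qed.

(** Two integrations by parts on w^(n+2), where w = x (1 + x): since
    w'^2 = 4 w + 1 and w'' = 2, the second derivative of w^(n+2) is again a
    combination of powers of w. *)
Lemma laplaceXX1_rec c n : c != 0 ->
  c ^+ 2 * laplaceXX1 c n.+2 =
  n.+2%:R * ((4 * n%:R + 6) * laplaceXX1 c n.+1 + n.+1%:R * laplaceXX1 c n).
Proof.
move=> c0; have := laplace_deriv (XX1 ^+ n.+2)^`() c0.
rewrite (laplace_deriv (XX1 ^+ n.+2))// hornerXX1 subr0 -/(laplaceXX1 c _).
rewrite mulrA -expr2.
rewrite deriv_exp /= hornerMn hornerM hornerXX1 mulr0 mul0rn subr0 => <-.
rewrite (_ : _^`() = (n.+2%:R * (4 * n%:R + 6)) *: XX1 ^+ n.+1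
                     + (n.+2%:R * n.+1%:R) *: XX1 ^+ n).
  by rewrite laplace_comb// -/(laplaceXX1 c _) -/(laplaceXX1 c _); ring.
have -> : n.+2%:R * (4 * n%:R + 6) = (n.+2 * (4 * n + 6))%:R :> F.
  by rewrite natrM natrD natrM.
rewrite -natrM !scaler_nat.
rewrite derivMn derivM deriv_exp derivXX1 /= derivD derivMn derivX derivC exprS.
by move: (XX1 ^+ n) => wn; rewrite /XX1; ring.
Qed.

(** With w = x (1 + x), one has 2 (1 + x)^2 = 2 w + 1 + w', hence
    x^n (1 + x)^(n+2) is a combination of w^(n+1), w^n and the derivative of
    w^(n+1). *)
Lemma laplace_Xn_XD1n c n : c != 0 ->
  2 * n.+1%:R * laplace c ('X^n * ('X + 1) ^+ n.+2)
  = (2 * n.+1%:R + c) * laplaceXX1 c n.+1 + n.+1%:R * laplaceXX1 c n.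
Proof.
move=> c0.
have e : (2 * n.+1%:R) *: ('X^n * ('X + 1) ^+ n.+2) =
  1 *: ((2 * n.+1%:R) *: XX1 ^+ n.+1 + n.+1%:R *: XX1 ^+ n)
  + 1 *: (XX1 ^+ n.+1)^`() :> {poly F}.
  rewrite -natrM !scale1r !scaler_nat deriv_exp derivXX1 /= !exprS /XX1 exprMn.
  by move: 'X^n (('X + 1) ^+ n) => a b; ring.
have /(congr1 (laplace c)) := e.
rewrite laplace_comb// laplace_comb// laplace_deriv// hornerXX1 subr0 !mul1r.
rewrite laplace_scale// => ->.
by rewrite -/(laplaceXX1 c _) -/(laplaceXX1 c _); ring.
Qed.

(** The three-term recurrence of the Bessel polynomials at 1 / theta, with
    their initial values. *)
Definition bessel_recurrence (theta : F) (y : nat -> F) :=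
  [/\ y 0%N = 1, y 1%N = 1 + theta^-1 &
      forall n, y n.+2 = (2 * n%:R + 3) / theta * y n.+1 + y n].

(** The n-th Bessel polynomial at 1 / theta, in its integral representation
    over the half-line. *)
Definition bessel_poly (theta : F) n : F :=
  (2 * theta) ^+ n.+1 * laplaceXX1 (2 * theta) n / n`!%:R.

Lemma bessel_poly_recurrence theta :
  0 < theta -> bessel_recurrence theta (bessel_poly theta).
Proof.
move=> h; have c0 : 2 * theta != 0 by rewrite mulf_neq0// gt_eqF.
split.
- by rewrite /bessel_poly laplaceXX1_0// divr1 expr1 mulfV.
- by rewrite /bessel_poly laplaceXX1_1// divr1; field; rewrite gt_eqF.
move=> n; have n1 : n%:R + 1 != 0 :> F by rewrite natr1 pnatr_eq0.
have n2 : n%:R + 2 != 0 :> F by rewrite -natrD pnatr_eq0 addn2.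
have f0 : n`!%:R != 0 :> F by rewrite pnatr_eq0 -lt0n fact_gt0.
have := laplaceXX1_rec n c0; rewrite -[n.+2%:R]natr1 -[n.+1%:R]natr1 => e.
rewrite /bessel_poly.
have -> : laplaceXX1 (2 * theta) n.+2 =
    (n%:R + 2) * ((4 * n%:R + 6) * laplaceXX1 (2 * theta) n.+1 +
    (n%:R + 1) * laplaceXX1 (2 * theta) n) / (2 * theta) ^+ 2.
  apply: (mulfI (expf_neq0 2 c0)).
  by rewrite e [RHS]mulrC divfK ?expf_neq0//; ring.
rewrite !factS !natrM -[n.+2%:R]natr1 -[n.+1%:R]natr1 !exprS; field.
by rewrite f0 n1 gt_eqF//= -addrA (_ : 1 + 1 = 2).
Qed.

End LaplacePoly.

(** * The polynomial inequality behind log-concavity *)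

Section ConcavityGap.
Context {R : realFieldType}.
Implicit Types n t a th : R.

(** If t = th y_n / y_(n-1), this is, up to a positive factor, the difference
    u_n^2 - u_(n-1) u_(n+1) for u_n = ((n + th) y_n + th y_(n-1)) / n!: the
    recurrence expresses y_(n-2), y_n and y_(n+1) through y_(n-1) and t. *)
Definition concavity_gap n th t : R :=
  (n + 1) * ((n + th) * t + th ^+ 2) ^+ 2
  - n * (t + th - n)
    * ((n + 1 + th) * (th ^+ 2 + (2 * n + 1) * t) + th ^+ 2 * t).

(** The opposite of the coefficient of t ^+ 2 in [concavity_gap n th t]. *)
Definition gap_lead n th : R := n ^+ 3 + 2 * n ^+ 2 + n - n * th - th ^+ 2.

Lemma quadratic_gt0 (a b c x : R) :
  0 < a -> b ^+ 2 < 4 * a * c -> 0 < a * x ^+ 2 + b * x + c.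
Proof.
move=> a0 d; rewrite -(pmulr_rgt0 _ a0) -(pmulr_rgt0 _ (ltr0n R 4 : 0 < 4 :> R)).
have := sqr_ge0 (2 * a * x + b).
rewrite (_ : (2 * a * x + b) ^+ 2 =
  4 * (a * (a * x ^+ 2 + b * x + c)) + (b ^+ 2 - 4 * a * c)); first lra.
ring.
Qed.

(** For th large compared with n, all coefficients in t are nonnegative. *)
Lemma concavity_gap_gt0_large n th t : 2 <= n -> 0 < th -> 0 < t ->
  gap_lead n th <= 0 -> 0 < concavity_gap n th t.
Proof.
rewrite /gap_lead => n2 th0 t0 D0.
have -> : concavity_gap n th t =
  - (n ^+ 3 + 2 * n ^+ 2 + n - n * th - th ^+ 2) * t ^+ 2
  + (2 * th ^+ 3 - n * (2 * n + 1) * th + 2 * n ^+ 4 + 3 * n ^+ 3 + n ^+ 2) * t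
  + th ^+ 2 * (th ^+ 2 - n * th + n ^+ 3 + n ^+ 2).
  by rewrite /concavity_gap; ring.
have B : 0 < 2 * th ^+ 3 - n * (2 * n + 1) * th + 2 * n ^+ 4 + 3 * n ^+ 3 + n ^+ 2.
  (* th ^+ 3 lies above its tangent at th = n: the difference is
     (th + 2 * n) * (th - n) ^+ 2 *)
  have -> : 2 * th ^+ 3 - n * (2 * n + 1) * th + 2 * n ^+ 4 + 3 * n ^+ 3 + n ^+ 2
    = 2 * (th + 2 * n) * (th - n) ^+ 2 + n * th * (4 * n - 1)
      + n ^+ 2 * (2 * n ^+ 2 + (-1) * n + 1) by ring.
  apply: ltr_wpDl; last first.
    by apply: mulr_gt0; [apply: exprn_gt0|apply: quadratic_gt0]; lra.
  by apply: addr_ge0; apply: mulr_ge0; rewrite ?sqr_ge0 ?mulr_ge0//; lra.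
have A : 0 < th ^+ 2 - n * th + n ^+ 3 + n ^+ 2.
  rewrite (_ : _ + n ^+ 2 = 1 * th ^+ 2 + (- n) * th + (n ^+ 3 + n ^+ 2)); last ring.
  apply: quadratic_gt0 => //.
  have := exprn_gt0 3 (lt_le_trans (ltr0n R 2) n2).
  have := exprn_gt0 2 (lt_le_trans (ltr0n R 2) n2); lra.
have := mulr_gt0 B t0; have := mulr_gt0 (exprn_gt0 2 th0) A.
have : 0 <= - (n ^+ 3 + 2 * n ^+ 2 + n - n * th - th ^+ 2) * t ^+ 2.
  by apply: mulr_ge0; [lra|exact: sqr_ge0].
lra.
Qed.

(** When [gap_lead n th] is positive, the bound
    t ^+ 2 - 2 n t - th ^+ 2 < t - (4 n - 2) minorizes the gap by the affine
    function [minorant_cst n th - minorant_slope n th * t] of t. *)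
Definition minorant_cst n th : R :=
  th ^+ 2 * (2 * th ^+ 2 - n ^+ 2 - n) + gap_lead n th * (4 * n - 2).
Definition minorant_slope n th : R :=
  gap_lead n th
  - (2 * th ^+ 3 + 2 * n * th ^+ 2 - n * th - n ^+ 3 - n ^+ 2).

(** The affine minorant at t = 2 n - 1 + th ^+ 2 / a, multiplied by a; this t
    is the ratio that follows a in the recurrence. *)
Definition minorant n th a : R :=
  minorant_cst n th * a - minorant_slope n th * ((2 * n - 1) * a + th ^+ 2).

Lemma minorant_increasing n th a b : 2 <= n -> 0 < th -> a <= b ->
  0 < minorant n th a -> 0 < minorant n th b.
Proof.
move=> n2 th0 ab ha.
suff slope : 0 < minorant_cst n th - (2 * n - 1) * minorant_slope n th.
  rewrite (_ : minorant n th b = minorant n th a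
    + (b - a) * (minorant_cst n th - (2 * n - 1) * minorant_slope n th)); last first.
    by rewrite /minorant; ring.
  by apply: ltr_wpDr => //; apply: mulr_ge0; [rewrite subr_ge0|exact: ltW].
have [m m0 ->] : exists2 m, 0 <= m & n = m + 2 by exists (n - 2); lra.
(* as polynomials in m, all coefficients are positive for th > 0 *)
have -> : minorant_cst (m + 2) th - (2 * (m + 2) - 1) * minorant_slope (m + 2) th =
  (3 * th ^+ 2 + (-12) * th + 18) + m * (7 * th ^+ 2 + (-14) * th + 27)
   + m ^+ 2 * (3 * th ^+ 2 + (-4) * th + 13)
   + (2 * m ^+ 3 + th ^+ 3 * (6 + 4 * m + 2 * th)).
  by rewrite /minorant_cst /minorant_slope /gap_lead; ring.
have h0 : 0 < 3 * th ^+ 2 + (-12) * th + 18 by apply: quadratic_gt0; lra.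
have h1 : 0 <= m * (7 * th ^+ 2 + (-14) * th + 27).
  by apply: mulr_ge0 => //; apply/ltW/quadratic_gt0; lra.
have h2 : 0 <= m ^+ 2 * (3 * th ^+ 2 + (-4) * th + 13).
  by apply: mulr_ge0; [exact: sqr_ge0|apply/ltW/quadratic_gt0; lra].
have h3 : 0 <= 2 * m ^+ 3 by rewrite mulr_ge0 ?exprn_ge0.
have h4 : 0 <= th ^+ 3 * (6 + 4 * m + 2 * th).
  by apply: mulr_ge0; [apply/exprn_ge0/ltW|lra].
lra.
Qed.

Lemma minorant_gt0 n th : 3 <= n -> 0 < th -> 0 < minorant n th (2 * n - 3).
Proof.
move=> n3 th0; have [m m0 ->] : exists2 m, 0 <= m & n = m + 3 by exists (n - 3); lra.
have -> : minorant (m + 3) th (2 * (m + 3) - 3)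
  = (180 - 90 * th - 45 * th ^+ 2 + 30 * th ^+ 3 + 13 * th ^+ 4 + 2 * th ^+ 5)
  + m * (297 - 126 * th - 8 * th ^+ 2 + 32 * th ^+ 3 + 6 * th ^+ 4)
  + m ^+ 2 * (14 * th ^+ 2 + (-56) * th + 175)
  + m ^+ 3 * (4 * th ^+ 2 + (-8) * th + 44)
  + (4 * m ^+ 4 + 8 * th ^+ 3 * m ^+ 2).
  by rewrite /minorant /minorant_cst /minorant_slope /gap_lead; ring.
have h0 : 0 < 180 - 90 * th - 45 * th ^+ 2 + 30 * th ^+ 3 + 13 * th ^+ 4 + 2 * th ^+ 5.
  have := mulr_ge0 (sqr_ge0 (th - 1)) (ltW th0).
  have := sqr_ge0 (th ^+ 2 - 1).
  have : 0 < th ^+ 5 by exact: exprn_gt0.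
  have := sqr_ge0 (th - 1).
  nra.
have h1 : 0 <= m * (297 - 126 * th - 8 * th ^+ 2 + 32 * th ^+ 3 + 6 * th ^+ 4).
  apply: (mulr_ge0 m0).
  have := mulr_ge0 (sqr_ge0 (th - 1)) (ltW th0).
  have := sqr_ge0 (th - 1).
  have : 0 < th ^+ 4 by exact: exprn_gt0.
  nra.
have h2 : 0 <= m ^+ 2 * (14 * th ^+ 2 + (-56) * th + 175).
  by apply: mulr_ge0; [exact: sqr_ge0|apply/ltW/quadratic_gt0; lra].
have h3 : 0 <= m ^+ 3 * (4 * th ^+ 2 + (-8) * th + 44).
  by apply: mulr_ge0; [exact: exprn_ge0|apply/ltW/quadratic_gt0; lra].
have h4 : 0 <= 4 * m ^+ 4 by rewrite mulr_ge0 ?exprn_ge0.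
have h5 : 0 <= 8 * th ^+ 3 * m ^+ 2.
  by apply: mulr_ge0; [apply/mulr_ge0/exprn_ge0/ltW|exact: sqr_ge0].
lra.
Qed.

(** At n = 2 the value a = 2 n - 3 = 1 is too small for some th; the exact
    first ratio 1 + th takes its place. *)
Lemma minorant2_gt0 th : 0 < th -> 0 < minorant 2 th (1 + th).
Proof.
move=> th0.
have -> : minorant 2 th (1 + th)
  = 18 + 6 * th - 39 * th ^+ 2 + 9 * th ^+ 3 + 13 * th ^+ 4 + 4 * th ^+ 5.
  by rewrite /minorant /minorant_cst /minorant_slope /gap_lead; ring.
have := mulr_ge0 (sqr_ge0 (th - 1)) (ltW th0).
have := sqr_ge0 (th ^+ 2 - 1).
have := mulr_ge0 (sqr_ge0 (th ^+ 2 - 1)) (ltW th0).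
have := sqr_ge0 (th - 1).
nra.
Qed.

Lemma concavity_gap_gt0_small n th a t : 2 <= n -> 0 < th -> 0 < a ->
  0 < minorant n th a -> t = 2 * n - 1 + th ^+ 2 / a ->
  t ^+ 2 - 2 * n * t - th ^+ 2 < t - (4 * n - 2) ->
  0 < gap_lead n th -> 0 < concavity_gap n th t.
Proof.
move=> n2 th0 a0 hc tE Q D0.
have hN : 0 < minorant_cst n th - minorant_slope n th * t.
  rewrite -(pmulr_lgt0 _ a0) tE (_ : (_ - _) * a = minorant n th a)//.
  by rewrite /minorant; field; rewrite gt_eqF.
have -> : concavity_gap n th t = (minorant_cst n th - minorant_slope n th * t)
   + gap_lead n th * ((t - (4 * n - 2)) - (t ^+ 2 - 2 * n * t - th ^+ 2)).
  by rewrite /concavity_gap /minorant_cst /minorant_slope /gap_lead; ring.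
by apply: addr_gt0 => //; apply: mulr_gt0 => //; rewrite subr_gt0.
Qed.

End ConcavityGap.

(** * Ratios of Bessel polynomials and log-concavity *)

Section BesselRatio.
Context {R : realFieldType}.
Implicit Types (th : R) (y : nat -> R).

Lemma bessel_recurrence_gt0 th y n : 0 < th -> bessel_recurrence th y -> 0 < y n.
Proof.
move=> th0 [y0 y1 yS]; suff : 0 < y n /\ 0 < y n.+1 by case.
elim: n => [|n [yn ySn]]; first by rewrite y0 y1 addr_gt0 ?invr_gt0.
by split => //; rewrite yS addr_gt0// mulr_gt0// divr_gt0// ltr_wpDl// mulr_ge0.
Qed.

(** The ratio theta y_n / y_(n-1) at n = k + 1. *)
Definition bessel_ratio th y k : R := th * y k.+1 / y k.

Lemma bessel_ratio0 th y : 0 < th -> bessel_recurrence th y ->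
  bessel_ratio th y 0 = th + 1.
Proof.
by move=> th0 [y0 y1 _]; rewrite /bessel_ratio y0 y1; field; rewrite gt_eqF.
Qed.

Lemma bessel_ratioS th y k : 0 < th -> bessel_recurrence th y ->
  bessel_ratio th y k.+1 = 2 * k.+2%:R - 1 + th ^+ 2 / bessel_ratio th y k.
Proof.
move=> th0 yrec; have y0 m := bessel_recurrence_gt0 m th0 yrec.
case: yrec => _ _ yS; rewrite /bessel_ratio yS -(natr1 k.+1) -natr1; field.
by rewrite !gt_eqF ?y0.
Qed.

(** The last two bounds say that t_n lies between n + sqrt((n-1)^2 + th^2) and
    n + sqrt(n^2 + th^2).  The recurrence is decreasing in t_n, so each of them
    at n yields the other one at n + 1. *)
Lemma bessel_ratio_bounds th y k : 0 < th -> bessel_recurrence th y ->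
  let n : R := k.+1%:R in let t := bessel_ratio th y k in
  [/\ th + n <= t, 2 * n - 1 < t,
   t ^+ 2 - 2 * n * t - th ^+ 2 <= 0 &
   0 <= t ^+ 2 - 2 * n * t - th ^+ 2 + 2 * n - 1].
Proof.
move=> th0 yrec; elim: k => [|k] /=.
  by rewrite bessel_ratio0// mulr1n; split; lra.
set n : R := k.+1%:R; set a := bessel_ratio th y k => -[h1 h2 h3 h4].
have n1 : 1 <= n by rewrite ler1n.
have a0 : 0 < a by lra.
set v := th ^+ 2 / a.
have v0 : 0 < v by rewrite divr_gt0 ?exprn_gt0.
have va : v * a = th ^+ 2 by rewrite divfK ?gt_eqF.
have nE : k.+2%:R = n + 1 by rewrite natr1.
rewrite bessel_ratioS// -/a -/v nE -va.
have h3' : a <= 2 * n + v.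
  by rewrite -(ler_pM2l a0) -subr_ge0; move: h3; rewrite -va; nra.
have va1 : v <= a.
  by rewrite -(ler_pM2r a0) va -expr2 ler_sqr ?nnegrE; lra.
split.
- lra.
- lra.
- have : 0 <= (a - 2 * n - v) * v + (2 * n - 1) * (v / a).
    rewrite (_ : _ + _ = (a ^+ 2 - 2 * n * a - th ^+ 2 + 2 * n - 1) * (v / a)).
      by rewrite mulr_ge0// divr_ge0// ltW.
    by rewrite -va; field; rewrite gt_eqF.
  have : v / a <= 1 by rewrite ler_pdivrMr// mul1r.
  have : 0 <= v / a by rewrite divr_ge0// ltW.
  nra.
- have := mulr_ge0 (ltW v0) (_ : 0 <= 2 * n + v - a).
  rewrite subr_ge0 => /(_ h3'); lra.
Qed.

(** The lower bounds on a = t_(n-1) add up to a^2 - (2 n - 3) a - th^2 > 0;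
    through t_n = 2 n - 1 + th^2 / a this is the upper bound on t_n that
    [concavity_gap_gt0_small] asks for. *)
Lemma concavity_gap_bessel_ratio th y k : 0 < th -> bessel_recurrence th y ->
  0 < concavity_gap k.+2%:R th (bessel_ratio th y k.+1).
Proof.
move=> th0 yrec; have [] := bessel_ratio_bounds k th0 yrec.
set n : R := k.+1%:R; set a := bessel_ratio th y k => h1 h2 h3 h4.
have n1 : 1 <= n by rewrite ler1n.
have a0 : 0 < a by lra.
have nE : k.+2%:R = n + 1 :> R by rewrite natr1.
have tE : bessel_ratio th y k.+1 = 2 * (n + 1) - 1 + th ^+ 2 / a.
  by rewrite bessel_ratioS// nE.
rewrite nE.
have v0 : 0 < th ^+ 2 / a by rewrite divr_gt0 ?exprn_gt0.
have [D|D] := leP (gap_lead (n + 1) th) 0.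
  by apply: concavity_gap_gt0_large => //; lra.
apply: (@concavity_gap_gt0_small _ _ _ a) => //; first lra.
- case: k @n @a h1 h2 h3 h4 n1 a0 {nE tE v0 D} => [|k] n a h1 h2 h3 h4 n1 a0.
    rewrite /a bessel_ratio0// /n (_ : 1%:R + 1 = 2); last lra.
    by rewrite addrC; exact: minorant2_gt0.
  apply: (@minorant_increasing _ _ _ (2 * (n + 1) - 3)) => //; try lra.
  apply: minorant_gt0 => //; rewrite /n -addn2 natrD.
  by have := ler0n R k; lra.
- rewrite tE; set v := th ^+ 2 / a in v0 *.
  have va : v * a = th ^+ 2 by rewrite divfK ?gt_eqF.
  have : 0 < v * (a - (2 * n - 1) - v).
    rewrite (_ : _ * _ = ((a ^+ 2 - 2 * n * a - th ^+ 2 + 2 * n - 1)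
                          + (a - (2 * n - 1))) * (v / a)).
      by apply: mulr_gt0; [lra|exact: divr_gt0].
    by rewrite -va; field; rewrite gt_eqF.
  by rewrite -va; nra.
Qed.

(** The part of psi theta0 theta1 n that is not geometric in n. *)
Definition psi_core th y n : R := ((n%:R + th) * y n + th * y n.-1) / n`!%:R.

Lemma psi_core_gt0 th y n : 0 < th -> bessel_recurrence th y -> 0 < psi_core th y n.
Proof.
move=> th0 yrec; have y0 m := bessel_recurrence_gt0 m th0 yrec.
by rewrite divr_gt0 ?ltr0n ?fact_gt0// addr_gt0 ?mulr_gt0// ltr_wpDl.
Qed.

Lemma psi_core_log_concave th y k : 0 < th -> bessel_recurrence th y ->
  psi_core th y k.+1 * psi_core th y k.+3 < psi_core th y k.+2 ^+ 2.
Proof.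
move=> th0 yrec; have y0 m := bessel_recurrence_gt0 m th0 yrec.
have := concavity_gap_bessel_ratio k th0 yrec.
case: yrec => _ _ yS; rewrite /psi_core /=.
set n : R := k.+2%:R; set t := bessel_ratio th y k.+1; set u := y k.+1.
have u0 : 0 < u by exact: y0.
have E2 : y k.+2 = t * u / th.
  by rewrite /t /bessel_ratio -/u; field; rewrite !gt_eqF.
have nE : k%:R = n - 2 by rewrite /n -(addn2 k) natrD addrK.
have n1E : k.+1%:R = n - 1 by rewrite /n -(natr1 k.+1) addrK.
have n2E : k.+3%:R = n + 1 :> R by rewrite /n natr1.
have E1 : y k = u * (t - (2 * n - 1)) / th.
  have := yS k; rewrite E2 -/u nE => H.
  have -> : y k = t * u / th - (2 * (n - 2) + 3) / th * u by rewrite H; ring.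
  by field; rewrite gt_eqF.
have E3 : y k.+3 = u * ((2 * n + 1) * t + th ^+ 2) / th ^+ 2.
  by rewrite yS E2 n1E -/u; field; rewrite gt_eqF.
rewrite E1 E2 E3.
have f0 : 0 < k.+1`!%:R :> R by rewrite ltr0n fact_gt0.
have -> : k.+3`!%:R = (n + 1) * n * k.+1`!%:R :> R.
  by rewrite !factS !natrM mulrA; congr (_ * _ * _).
have -> : k.+2`!%:R = n * k.+1`!%:R :> R.
  by rewrite factS natrM; congr (_ * _).
rewrite n1E n2E; set f := k.+1`!%:R in f0 *.
have n0 : 0 < n by rewrite ltr0n.
move=> G0; rewrite -subr_gt0.
rewrite (_ : _ - _ / _ * _ = concavity_gap n th t
  * (u ^+ 2 / (th ^+ 2 * n ^+ 2 * (n + 1) * f ^+ 2))); last first.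
  by rewrite /concavity_gap; field; rewrite !gt_eqF//; lra.
by rewrite mulr_gt0// divr_gt0 ?exprn_gt0// !mulr_gt0 ?exprn_gt0// addr_gt0.
Qed.

End BesselRatio.

(** * Primitives on the half-line *)

Section HalfLine.
Context {R : realType}.
Implicit Types (f F : R -> R) (l c u : R) (p : {poly R}).
Notation mu := (@lebesgue_measure R).

Definition half_line_primitive f F l :=
  [/\ forall x : R, 0 < x -> is_derive x 1 F (f x),
      F x @[x --> 0^'+] --> F 0 & F x @[x --> +oo%R] --> l].

Lemma integral_half_line_primitive f F l :
  continuous f -> (forall x, 0 <= x -> 0 <= f x) -> half_line_primitive f F l ->
  (\int[mu]_(x in `]0%R, +oo[) (f x)%:E = (l - F 0)%:E)%E.
Proof.
move=> cf f0 [dF F0 Fl].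
rewrite integral_itv_obnd_cbnd; last first.
  apply/measurable_EFinP; apply: measurable_funTS.
  exact: continuous_measurable_fun.
rewrite EFinB; apply: ge0_continuous_FTC2y => //.
- exact: continuous_subspaceT.
- by move=> x /dF[].
- by move=> x; rewrite in_itv/= andbT => /dF[_ <-]; rewrite derive1E.
Qed.

Lemma is_derive_continuous f (df x : R) :
  is_derive x 1 f df -> f y @[y --> x] --> f x.
Proof.
by move=> [h _]; apply: differentiable_continuous; apply/derivable1_diffP.
Qed.

Lemma cvg_Xn_expRN c n :
  0 < c -> x ^+ n * expR (- (c * x)) @[x --> +oo%R] --> 0.
Proof.
(* one term of the exponential series: e^(c x) >= (c x)^(n+1) / (n+1)! *)
move=> c0; pose K := n.+1`!%:R / c ^+ n.+1.
apply: (@squeeze_cvgr _ _ _ _ (fun=> 0) (fun x => K * x^-1)).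
- near=> x; have x0 : 0 < x by near: x; exact: nbhs_pinfty_gt.
  rewrite mulr_ge0 ?expR_ge0 ?exprn_ge0 ?(ltW x0)//=.
  rewrite expRN ler_pdivrMr ?expR_gt0//.
  have := @expR_ge1Dxn R (c * x) n (ltW (mulr_gt0 c0 x0)).
  move=> h; have {h} : (c * x) ^+ n.+1 / n.+1`!%:R <= expR (c * x) by lra.
  have Kx : 0 <= K * x^-1.
    by rewrite mulr_ge0 ?divr_ge0 ?exprn_ge0 ?invr_ge0 ?(ltW x0) ?(ltW c0).
  move=> /(ler_wpM2l Kx); apply: le_trans.
  rewrite le_eqVlt /K exprMn [x ^+ n.+1]exprS; apply/orP; left; apply/eqP; field.
  by rewrite !gt_eqF ?exprn_gt0 ?ltr0n ?fact_gt0.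
- exact: cvg_cst.
- rewrite -[X in _ --> X](mulr0 K); apply: cvgM; first exact: cvg_cst.
  apply/gtr0_cvgV0; last exact: cvg_id.
  by near=> x; near: x; exact: nbhs_pinfty_gt.
Unshelve. all: by end_near. Qed.

Lemma cvg_poly_expRN c p :
  0 < c -> p.[x] * expR (- (c * x)) @[x --> +oo%R] --> 0.
Proof.
move=> c0.
have -> : (fun x : R => p.[x] * expR (- (c * x))) =
  (fun x => \sum_(i < size p) (p`_i * (x ^+ i * expR (- (c * x))))).
  apply/funext => x; rewrite horner_coef mulr_suml.
  by apply: eq_bigr => i _; rewrite mulrA.
rewrite [X in _ --> X](_ : _ = \sum_(i < size p) (0 : R)); last by rewrite big1.
apply: cvg_big => [|i _]; first exact: add_continuous.
rewrite -[X in _ --> X](mulr0 p`_i); apply: cvgM; first exact: cvg_cst.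
exact: cvg_Xn_expRN.
Qed.

Lemma is_derive_poly_expR c u p (x : R) :
  is_derive x 1 (fun x => p.[x + u] * expR (- (c * (x + u))))
   ((p^`().[x + u] - c * p.[x + u]) * expR (- (c * (x + u)))).
Proof.
have h1 : is_derive x 1 (fun x => p.[x + u]) (p^`().[x + u] * 1).
  apply: (@is_derive1_comp _ (horner p) (fun x => x + u)).
  by rewrite -[X in is_derive _ _ _ X]addr0; apply: is_deriveD.
have h2 : is_derive x 1 (fun x : R => - (c * (x + u))) (- c).
  have -> : (fun x : R => - (c * (x + u))) = (fun x => (- c) * x + (- c * u)).
    by apply/funext => y; ring.
  rewrite -[X in is_derive _ _ _ X]addr0 -[X in is_derive _ _ _ (X + _)]mulr1.
  by apply: is_deriveD.
have h3 : is_derive x 1 (fun x : R => expR (- (c * (x + u))))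
    (expR (- (c * (x + u))) * - c).
  exact: (@is_derive1_comp _ expR (fun x => - (c * (x + u)))).
apply: (is_derive_eq (@is_deriveM _ _ _ _ _ _ _ _ h1 h3)).
by rewrite /GRing.scale/=; ring.
Qed.

(** The shift by u is what integrating out one observation requires, u being
    the sum of the others. *)
Lemma integral_poly_expR c u p : 0 < c -> 0 <= u -> nneg_coef p ->
  (\int[mu]_(x in `]0%R, +oo[) (p.[x + u] * expR (- (c * (x + u))))%:E
   = ((deriv_resolvent c p).[u] * expR (- (c * u)))%:E)%E.
Proof.
move=> c0 u0 p0.
pose F x := (- deriv_resolvent c p).[x + u] * expR (- (c * (x + u))).
have dF (x : R) : is_derive x 1 F (p.[x + u] * expR (- (c * (x + u)))).
  apply: (is_derive_eq (is_derive_poly_expR c u (- deriv_resolvent c p) x)).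
  congr (_ * _); rewrite -{3}(deriv_resolventK p (lt0r_neq0 c0)).
  by rewrite derivN !hornerE; ring.
rewrite (@integral_half_line_primitive _ F 0).
- by rewrite sub0r /F hornerN mulNr opprK add0r.
- by move=> x; exact: (is_derive_continuous (is_derive_poly_expR c u p x)).
- move=> x x0; rewrite mulr_ge0 ?expR_ge0//.
  by apply: nneg_coef_horner => //; exact: addr_ge0.
split.
- by move=> x _; exact: dF.
- by apply: cvg_at_right_filter; exact: (is_derive_continuous (dF 0)).
- apply: (@cvg_comp _ _ _ (fun x => x + u)
    (fun x => (- deriv_resolvent c p).[x] * expR (- (c * x))) _ (pinfty_nbhs R)).
    exact: cvg_addrr.
  exact: cvg_poly_expRN.
Qed.

End HalfLine.

(** * Integrals of functions of the sample sum *)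

Section SampleSum.
Context {R : realType}.
Implicit Types (c : R) (p : {poly R}) (n : nat).

Definition tuple_sum n (s : n.-tuple (measurableTypeR R)) : R :=
  \sum_(i < n) tnth s i.

Lemma measurable_tuple_sum n : measurable_fun setT (@tuple_sum n).
Proof. by apply: measurable_sum => i; exact: measurable_tnth. Qed.

Lemma measurable_sample_space n : measurable (@sample_space R n).
Proof.
rewrite (_ : @sample_space R n =
  \bigcap_(i in [set: 'I_n]) ((fun s => tnth s i) @^-1` `]0, +oo[)); last first.
  apply/seteqP; split => s /= h i; last first.
    by have := h i I; rewrite /= in_itv/= andbT.
  by move=> _ /=; rewrite in_itv/= andbT; exact: h.
apply: fin_bigcap_measurable => //= i _; rewrite -[X in measurable X]setTI.
exact: measurable_tnth.
Qed.

Lemma tuple_sum_ge0 n (s : n.-tuple (measurableTypeR R)) :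
  sample_space s -> 0 <= tuple_sum s.
Proof. by move=> h; apply: sumr_ge0 => i _; exact/ltW/h. Qed.

Lemma tuple_sum_cons n x (s : n.-tuple (measurableTypeR R)) :
  tuple_sum (cons_pair (x, s)) = x + tuple_sum s.
Proof.
rewrite /tuple_sum big_ord_recl; congr (_ + _); apply: eq_bigr => i _.
by rewrite /cons_pair !(tnth_nth 0).
Qed.

Lemma sample_space_cons n x (s : n.-tuple (measurableTypeR R)) :
  sample_space (cons_pair (x, s)) <-> 0 < (x : R) /\ sample_space s.
Proof.
split => [h|[x0 h] i].
  split; first by have := h ord0.
  by move=> i; have := h (lift ord0 i); rewrite !(tnth_nth 0).
case: (unliftP ord0 i) => [j ->|->]; last by [].
by have := h j; rewrite !(tnth_nth 0).
Qed.

Definition poly_expR_sum c p n (s : n.-tuple (measurableTypeR R)) : R :=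
  p.[tuple_sum s] * expR (- (c * tuple_sum s)).

Lemma measurable_poly_expR_sum c p n : measurable_fun setT (@poly_expR_sum c p n).
Proof.
have ct : continuous (fun x : R => p.[x] * expR (- (c * x))).
  move=> x; have := is_derive_poly_expR c 0 p x.
  by under eq_fun do rewrite addr0; exact: is_derive_continuous.
apply: (measurableT_comp (f := fun x : R => p.[x] * expR (- (c * x)))).
  exact: continuous_measurable_fun.
exact: measurable_tuple_sum.
Qed.

Lemma poly_expR_sum_ge0 c p n (s : n.-tuple (measurableTypeR R)) :
  nneg_coef p -> sample_space s -> 0 <= poly_expR_sum c p s.
Proof.
move=> p0 hs; rewrite mulr_ge0 ?expR_ge0//.
by apply: nneg_coef_horner => //; exact: tuple_sum_ge0.
Qed.

(** By Tonelli the first observation can be integrated out with the others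
    fixed, which replaces p by its resolvent. *)
Lemma integral_sum_tuple c p n : 0 < c -> nneg_coef p ->
  (\int[lebesgue_tuple n]_(s in @sample_space R n) (poly_expR_sum c p s)%:E
   = ((iter n (deriv_resolvent c) p).[0])%:E)%E.
Proof.
move=> c0; elim: n p => [|n IH] p p0.
  rewrite /= integral_dirac//=; first last.
  - by apply: measurable_funTS; apply/measurable_EFinP; exact: measurable_poly_expR_sum.
  - exact: measurable_sample_space.
  rewrite diracE mem_set; last by case.
  by rewrite mul1e /poly_expR_sum /tuple_sum big_ord0 mulr0 oppr0 expR0 mulr1.
rewrite iterSr -IH; last exact: nneg_coef_resolvent.
rewrite [LHS]ge0_integral_pushforward; first last.
- by move=> y /set_mem hy; rewrite lee_fin poly_expR_sum_ge0.
- by apply: measurable_funTS; apply/measurable_EFinP; exact: measurable_poly_expR_sum.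
- exact: measurable_sample_space.
- exact: measurable_cons_pair.
have mS : measurable (@cons_pair R n @^-1` @sample_space R n.+1).
  rewrite -[X in measurable X]setTI; apply: measurable_cons_pair => //.
  exact: measurable_sample_space.
rewrite integral_mkcond; set h := (X in integral _ _ X).
have mh : measurable_fun setT h.
  apply/(measurable_restrictT _ _).1 => //; apply: measurable_funTS.
  apply: measurableT_comp; last exact: measurable_cons_pair.
  by apply/measurable_EFinP; exact: measurable_poly_expR_sum.
have h0 z : (0 <= h z)%E.
  rewrite /h patchE; case: ifPn => // /set_mem hz.
  by rewrite lee_fin poly_expR_sum_ge0.
rewrite -/(lebesgue_tuple n) (fubini_tonelli2 h mh h0).
rewrite [RHS]integral_mkcond; apply: eq_integral => s _.
rewrite /fubini_G [RHS]patchE; case: ifPn => [/set_mem|/negP] hs.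
  rewrite -(@integral_poly_expR R c (tuple_sum s))//; last exact: tuple_sum_ge0.
  rewrite [RHS]integral_mkcond; apply: eq_integral => x _.
  rewrite /h !patchE; case: ifPn => [/set_mem /sample_space_cons[x0 _]|/negP hx].
    rewrite ifT ?/= ?/poly_expR_sum ?tuple_sum_cons//.
    by apply/mem_set; rewrite /= in_itv/= andbT.
  rewrite ifF//; apply/negP => /set_mem; rewrite /= in_itv/= andbT => x0.
  by apply: hx; apply/mem_set/sample_space_cons.
rewrite integral0_eq// => x _; rewrite /h patchE ifF//.
apply/negP => /set_mem /sample_space_cons[_ ?].
by apply: hs; exact/mem_set.
Qed.

End SampleSum.

(** * Modified Bessel functions at half-integers *)

Section BesselHalf.
Context {R : realType}.
Implicit Types (nu x t k m : R).
Notation mu := (@lebesgue_measure R).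

Definition sinh t : R := (expR t - expR (- t)) / 2.

Lemma is_derive_expRM k t : is_derive t 1 (fun t => expR (k * t)) (k * expR (k * t)).
Proof.
have h : is_derive t 1 (fun t => k * t) k.
  by rewrite -[X in is_derive _ _ _ X]mulr1; exact: is_deriveZ.
by rewrite mulrC; exact: (@is_derive1_comp _ expR (fun t => k * t)).
Qed.

Lemma is_derive_sinhM k t : is_derive t 1 (fun t => sinh (k * t)) (k * cosh (k * t)).
Proof.
have h1 := is_derive_expRM k t; have h2 := is_derive_expRM (- k) t.
have -> : (fun t => sinh (k * t)) = (fun t => 2^-1 * (expR (k * t) - expR (- k * t))).
  by apply/funext => s; rewrite /sinh mulNr mulrC.
apply: (is_derive_eq (is_deriveZ 2^-1 (is_deriveB h1 h2))).
by rewrite /cosh /GRing.scale/= !mulNr; ring.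
Qed.

Lemma is_derive_coshM k t : is_derive t 1 (fun t => cosh (k * t)) (k * sinh (k * t)).
Proof.
have h1 := is_derive_expRM k t; have h2 := is_derive_expRM (- k) t.
have -> : (fun t => cosh (k * t)) = (fun t => 2^-1 * (expR (k * t) + expR (- k * t))).
  by apply/funext => s; rewrite /cosh mulNr mulrC.
apply: (is_derive_eq (is_deriveZ 2^-1 (is_deriveD h1 h2))).
by rewrite /sinh /GRing.scale/= !mulNr; ring.
Qed.

Lemma cosh_gt0 t : 0 < cosh t.
Proof. by rewrite divr_gt0// addr_gt0// expR_gt0. Qed.

Lemma sinh0 : sinh 0 = 0.
Proof. by rewrite /sinh oppr0 subrr mul0r. Qed.

Lemma sinh_gt0 t : 0 < t -> 0 < sinh t.
Proof. by move=> t0; rewrite divr_gt0// subr_gt0 ltr_expR; lra. Qed.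

Lemma coshD1M nu t :
  cosh ((nu + 1) * t) = cosh ((nu - 1) * t) + 2 * sinh t * sinh (nu * t).
Proof.
by rewrite /cosh /sinh !mulrDl mulNr !mul1r !opprD opprK !expRD; field.
Qed.

Lemma cosh_half t : cosh t = 1 + 2 * sinh (2^-1 * t) ^+ 2.
Proof.
have e : expR (2^-1 * t) * expR (- (2^-1 * t)) = 1 by rewrite -expRD subrr expR0.
have e2 : expR t = expR (2^-1 * t) ^+ 2.
  by rewrite expr2 -expRD; congr expR; field.
have e3 : expR (- t) = expR (- (2^-1 * t)) ^+ 2.
  by rewrite expr2 -expRD; congr expR; field.
rewrite /cosh /sinh e2 e3; move: e; set a := expR _; set b := expR _ => e.
by transitivity (a * b + 2 * ((a - b) / 2) ^+ 2); [field|rewrite e].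
Qed.

Definition besselK_integrand nu x t : R := expR (- x * cosh t) * cosh (nu * t).

Lemma is_derive_expR_cosh x t :
  is_derive t 1 (fun t => expR (- x * cosh t)) (- x * sinh t * expR (- x * cosh t)).
Proof.
have hc : is_derive t 1 cosh (sinh t).
  have := is_derive_coshM 1 t; rewrite !mul1r.
  by have -> : (fun t => cosh (1 * t)) = cosh by apply/funext => s; rewrite mul1r.
have h : is_derive t 1 (fun t => - x * cosh t) (- x * sinh t) :=
  is_deriveZ (- x) hc.
rewrite mulrC; exact: (@is_derive1_comp _ expR (fun t => - x * cosh t)).
Qed.

Lemma continuous_besselK_integrand nu x : continuous (besselK_integrand nu x).
Proof.
move=> t; exact: (is_derive_continuous (@is_deriveM _ _ _ _ _ _ _ _
  (is_derive_expR_cosh x t) (is_derive_coshM nu t))).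
Qed.

Lemma cvg_expRy : @expR R t @[t --> +oo%R] --> +oo%R.
Proof.
apply/cvgryPge => A; near=> t.
have : A <= t by near: t; apply: nbhs_pinfty_ge; exact: num_real.
by have := expR_ge1Dx t; lra.
Unshelve. all: by end_near. Qed.

Lemma cvg_expR_cosh_sinh nu x : 0 <= nu -> 0 < x ->
  expR (- x * cosh t) * sinh (nu * t) @[t --> +oo%R] --> 0.
Proof.
(* with w = e^t and m >= nu, the function is at most w^m e^(- x w / 2) *)
move=> nu0 x0; pose m := (Num.truncn nu).+1.
have num : nu <= m%:R by apply/ltW/truncnS_gt.
apply: (@squeeze_cvgr _ _ _ _ (fun=> 0)
    (fun t => expR t ^+ m * expR (- (x / 2 * expR t)))).
- near=> t; have t0 : 0 < t by near: t; exact: nbhs_pinfty_gt.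
  have s0 : 0 <= sinh (nu * t).
    by rewrite divr_ge0// subr_ge0 ler_expR; have := mulr_ge0 nu0 (ltW t0); lra.
  rewrite mulr_ge0 ?expR_ge0//= [leLHS]mulrC.
  apply: ler_pM; [exact: s0|exact: expR_ge0| |].
    rewrite -expRM_natl; apply: (@le_trans _ _ (expR (nu * t))).
      rewrite /sinh; have := expR_gt0 (nu * t).
      by have := expR_gt0 (- (nu * t)); lra.
    by rewrite ler_expR ler_wpM2r// ltW.
  rewrite ler_expR mulNr lerN2 -mulrA ler_wpM2l ?(ltW x0)// /cosh.
  by have := expR_gt0 (- t); lra.
- exact: cvg_cst.
- apply: (@cvg_comp _ _ _ expR (fun w => w ^+ m * expR (- (x / 2 * w))) _
    (pinfty_nbhs R)).
    exact: cvg_expRy.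
  by apply: cvg_Xn_expRN; lra.
Unshelve. all: by end_near. Qed.

(** A value of K_nu(x) certified by a primitive of its integrand.  Unlike
    integrals of nonnegative functions, primitives can be combined with
    arbitrary signs without integrability conditions. *)
Definition besselK_primitive nu x k :=
  exists F l, half_line_primitive (besselK_integrand nu x) F l /\ k = l - F 0.

Lemma besselK_primitiveE nu x k : besselK_primitive nu x k -> besselK nu x = k.
Proof.
move=> [F [l [h ->]]]; rewrite /besselK /Rintegral.
rewrite (integral_half_line_primitive (@continuous_besselK_integrand nu x) _ h)//.
by move=> t _; rewrite mulr_ge0 ?expR_ge0// ltW// cosh_gt0.
Qed.

Lemma besselK_primitiveN nu x k :
  besselK_primitive nu x k -> besselK_primitive (- nu) x k.
Proof.
move=> [F [l [h e]]]; exists F, l; split=> //.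
suff -> : besselK_integrand (- nu) x = besselK_integrand nu x by [].
apply/funext => t; rewrite /besselK_integrand /cosh (mulNr nu) opprK.
by rewrite [X in _ * (X / _)]addrC.
Qed.

(** The recurrence of the Bessel functions: differentiating
    e^(- x cosh t) sinh(nu t) yields a relation between the integrands at
    nu - 1, nu and nu + 1. *)
Lemma besselK_primitive_rec nu x k m : 0 <= nu -> 0 < x ->
  besselK_primitive (nu - 1) x k -> besselK_primitive nu x m ->
  besselK_primitive (nu + 1) x (k + 2 * nu / x * m).
Proof.
move=> nu0 x0 [F [l [[dF F0 Fl] ->]]] [G [l' [[dG G0 Gl] ->]]].
(* the boundary term: it vanishes at both ends *)
pose H t := expR (- x * cosh t) * sinh (nu * t).
have dH t : is_derive t 1 H (nu * besselK_integrand nu x t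
    - x * (sinh t * sinh (nu * t) * expR (- x * cosh t))).
  apply: (is_derive_eq (@is_deriveM _ _ _ _ _ _ _ _
    (is_derive_expR_cosh x t) (is_derive_sinhM nu t))).
  by rewrite /besselK_integrand /GRing.scale/=; ring.
exists (fun t => F t + (2 * nu / x * G t - 2 / x * H t)),
  (l + (2 * nu / x * l' - 2 / x * 0)).
split; last by rewrite /H (mulr0 nu) sinh0; ring.
split.
- move=> t t0.
  apply: (is_derive_eq (is_deriveD (dF t t0)
    (is_deriveB (is_deriveZ (2 * nu / x) (dG t t0)) (is_deriveZ (2 / x) (dH t))))).
  rewrite /besselK_integrand coshD1M /GRing.scale/=; field.
  by rewrite gt_eqF.
- apply: cvgD => //; apply: cvgB; first by apply: cvgM => //; exact: cvg_cst.
  apply: cvgM; first exact: cvg_cst.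
  by apply: cvg_at_right_filter; exact: (is_derive_continuous (dH 0)).
- apply: cvgD => //; apply: cvgB; first by apply: cvgM => //; exact: cvg_cst.
  by apply: cvgM; [exact: cvg_cst|exact: cvg_expR_cosh_sinh].
Qed.

Notation gauss0 := (@gauss_integral_proof.integral0_gauss R).

Lemma integrable_gauss_itv (a : R) : mu.-integrable `[0, a] (EFin \o gauss_fun).
Proof.
apply: continuous_compact_integrable; first exact: segment_compact.
by apply: continuous_subspaceT; exact: continuous_gauss_fun.
Qed.

Lemma is_derive_gauss0 t : 0 < t -> is_derive t 1 gauss0 (gauss_fun t).
Proof.
move=> t0; have [] := @continuous_FTC1_closed R gauss_fun 0 t (t + 1).
- by rewrite ltrDl.
- exact: integrable_gauss_itv.
- exact: t0.
- exact: continuous_gauss_fun.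
by move=> d e; apply: (DeriveDef d); rewrite -derive1E; exact: e.
Qed.

Lemma gauss0_0 : gauss0 0 = 0.
Proof.
by rewrite /gauss_integral_proof.integral0_gauss set_itv1 Rintegral_set1.
Qed.

Lemma cvg_gauss0_0 : gauss0 t @[t --> 0] --> 0.
Proof. exact: (parameterized_integral_cvg_left ltr01 (integrable_gauss_itv 1)). Qed.

Lemma cvg_gauss0_y : gauss0 t @[t --> +oo%R] --> Num.sqrt pi / 2.
Proof.
have -> : gauss0 = (fun t => Num.sqrt (gauss0 t ^+ 2)).
  apply/funext => t; rewrite sqrtr_sqr ger0_norm//.
  exact: gauss_integral_proof.integral0_gauss_ge0.
have -> : Num.sqrt pi / 2 = Num.sqrt (pi / 4) :> R.
  rewrite sqrtrM ?pi_ge0// sqrtrV// (_ : 4 = 2 ^+ 2) ?sqrtr_sqr ?ger0_norm//.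
  ring.
apply: continuous_cvg; first exact: sqrt_continuous.
exact: gauss_integral_proof.cvg_integral0_gauss_sqr.
Qed.

(** The substitution v = sinh(t/2), for which cosh t = 1 + 2 v^2 and
    dv = cosh(t/2) / 2 dt, turns the integral into a Gaussian one. *)
Lemma besselK_primitive_half x : 0 < x ->
  besselK_primitive 2^-1 x (expR (- x) * Num.sqrt pi / Num.sqrt (2 * x)).
Proof.
move=> x0; pose b := Num.sqrt (2 * x).
have b0 : 0 < b by rewrite sqrtr_gt0; lra.
have b2 : b ^+ 2 = 2 * x by rewrite sqr_sqrtr//; lra.
pose a := 2 * expR (- x) / b.
exists (fun t => a * gauss0 (b * sinh (2^-1 * t))), (a * (Num.sqrt pi / 2)).
split; last first.
  rewrite mulr0 sinh0 mulr0 gauss0_0 mulr0 subr0 /a -/b; field.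
  by rewrite gt_eqF.
have dS t : is_derive t 1 (fun t => b * sinh (2^-1 * t))
    (b * (2^-1 * cosh (2^-1 * t))).
  exact: (is_deriveZ b (is_derive_sinhM 2^-1 t)).
split.
- move=> t t0.
  have s0 : 0 < b * sinh (2^-1 * t).
    by apply: mulr_gt0 => //; apply: sinh_gt0; exact: mulr_gt0.
  have := @is_derive1_comp _ gauss0 (fun t => b * sinh (2^-1 * t)) t _ _
     (is_derive_gauss0 s0) (dS t).
  move=> /(is_deriveZ a) h; apply: (is_derive_eq h).
  rewrite /besselK_integrand /gauss_fun exprMn b2 /GRing.scale/= (cosh_half t).
  have -> : - x * (1 + 2 * sinh (2^-1 * t) ^+ 2)
    = - x + - (2 * x * sinh (2^-1 * t) ^+ 2) by ring.
  by rewrite expRD /a; field; rewrite gt_eqF.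
- rewrite mulr0 sinh0 mulr0 gauss0_0; apply: cvgM; first exact: cvg_cst.
  apply: cvg_at_right_filter.
  apply: (@cvg_comp _ _ _ (fun t => b * sinh (2^-1 * t)) gauss0 _ (nbhs (0 : R)));
    last exact: cvg_gauss0_0.
  by have := is_derive_continuous (dS 0); rewrite mulr0 sinh0 mulr0.
- apply: cvgM; first exact: cvg_cst.
  apply: (@cvg_comp _ _ _ (fun t => b * sinh (2^-1 * t)) gauss0 _ (pinfty_nbhs R));
    last exact: cvg_gauss0_y.
  apply/cvgryPge => A; near=> t.
  have t0 : 0 < t by near: t; exact: nbhs_pinfty_gt.
  rewrite mulrC -ler_pdivrMr//.
  have : 1 + 2^-1 * t <= expR (2^-1 * t) by exact: expR_ge1Dx.
  have : expR (- (2^-1 * t)) <= 1 by rewrite -[leRHS]expR0 ler_expR; lra.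
  have : 4 * (A / b) <= t by near: t; apply: nbhs_pinfty_ge; exact: num_real.
  by rewrite /sinh; lra.
Unshelve. all: by end_near. Qed.

(** The predecessor at n = 0 is correct since K_(-1/2) = K_(1/2). *)
Lemma besselK_half (y : nat -> R) x n : 0 < x -> bessel_recurrence x y ->
  let C := expR (- x) * Num.sqrt pi / Num.sqrt (2 * x) in
  besselK (n%:R + 2^-1) x = C * y n /\ besselK (n%:R - 2^-1) x = C * y n.-1.
Proof.
move=> x0 [y0 y1 yS] C.
suff [h1 h2] : besselK_primitive (n%:R + 2^-1) x (C * y n) /\
               besselK_primitive (n%:R - 2^-1) x (C * y n.-1).
  by split; exact: besselK_primitiveE.
have h0 := besselK_primitive_half x0.
elim: n => [|n [h1 h2]].
  by rewrite y0 mulr1 add0r sub0r; split => //; exact: besselK_primitiveN.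
have -> : n.+1%:R - 2^-1 = n%:R + 2^-1 :> R by rewrite -natr1; field.
split => //; rewrite -natr1 addrAC.
have -> : C * y n.+1 = C * y n.-1 + 2 * (n%:R + 2^-1) / x * (C * y n).
  case: n {h1 h2} => [|n] /=; first by rewrite y0 y1; field; rewrite gt_eqF.
  by rewrite yS -natr1; field; rewrite gt_eqF.
apply: besselK_primitive_rec => //.
by have -> : n%:R + 2^-1 - 1 = n%:R - 2^-1 :> R by field.
Qed.

End BesselHalf.

(** * The expected posterior density *)

Section Psi.
Context {R : realType}.
Implicit Types (theta : R) (n : nat).

Lemma likelihoodE theta n (s : n.-tuple (measurableTypeR R)) :
  sample_space s ->
  likelihood theta s = theta ^+ n * expR (- (theta * tuple_sum s)).
Proof.
move=> hs.
rewrite /likelihood (eq_bigr (fun i => theta * expR (- (theta * tnth s i)))).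
  rewrite big_split/= prodr_const card_ord -expR_sum; congr (_ * expR _).
  by rewrite sumrN mulr_sumr.
by move=> i _; rewrite exponential_pdfE ?mulNr//; exact/ltW/hs.
Qed.

Lemma priorE theta : 0 <= theta -> prior theta = expR (- theta).
Proof. by move=> h; rewrite /prior exponential_pdfE// mul1r mulN1r. Qed.

Lemma marginalE n (s : n.-tuple (measurableTypeR R)) :
  sample_space s -> marginal s = n`!%:R / (tuple_sum s + 1) ^+ n.+1.
Proof.
move=> hs; have c0 : 0 < tuple_sum s + 1 by rewrite ltr_wpDl// tuple_sum_ge0.
rewrite -laplace_Xn1 ?gt_eqF// /marginal /Rintegral.
have := @integral_poly_expR R (tuple_sum s + 1) 0 'X^n c0 (lexx 0) (nneg_coefXn n).
rewrite mulr0 oppr0 expR0 mulr1 => h.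
rewrite -[RHS]/(fine (_%:E)) -h; congr fine; apply: eq_integral => x.
rewrite inE /= in_itv/= andbT => x0.
rewrite likelihoodE// priorE ?ltW// -mulrA -expRD addr0 hornerXn.
by congr (_ * expR _)%:E; ring.
Qed.

Lemma psi_laplace theta0 theta1 n : 0 < theta0 -> 0 < theta1 ->
  psi theta0 theta1 n.+1 =
  (theta0 * theta1) ^+ n.+1 * expR (- theta0) / n.+1`!%:R *
   (laplace (theta0 + theta1) ('X^n * ('X + 1) ^+ n.+2) / n`!%:R).
Proof.
move=> h0 h1; set c := theta0 + theta1.
have c0 : 0 < c by exact: addr_gt0.
pose K := (theta0 * theta1) ^+ n.+1 * expR (- theta0) / n.+1`!%:R.
have K0 : 0 <= K.
  by rewrite divr_ge0 ?mulr_ge0 ?expR_ge0 ?exprn_ge0 ?mulr_ge0 ?ltW.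
pose p : {poly R} := K *: ('X + 1) ^+ n.+2.
have p0 : nneg_coef p by move=> i; rewrite coefZ mulr_ge0// nneg_coefXD1n.
transitivity (iter n.+1 (deriv_resolvent c) p).[0].
  rewrite /psi /Rintegral -[RHS]/(fine (_%:E)) -(integral_sum_tuple n.+1 c0 p0).
  congr fine; apply: eq_integral => s /set_mem hs; congr EFin.
  rewrite /posterior !likelihoodE// priorE ?ltW// marginalE//.
  rewrite /poly_expR_sum /p hornerZ horner_exp hornerD hornerX hornerC /K /c.
  rewrite mulrDl opprD expRD exprMn.
  have t0 : tuple_sum s + 1 != 0 by rewrite gt_eqF// ltr_wpDl// tuple_sum_ge0.
  by field; rewrite ?expf_neq0 ?t0 ?pnatr_eq0 -?lt0n ?fact_gt0.
have -> : (iter n.+1 (deriv_resolvent c) p).[0] = laplace c ('X^n * p) / n`!%:R.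
  by rewrite laplace_Xn ?gt_eqF// mulrC mulKf// pnatr_eq0 -lt0n fact_gt0.
by rewrite /p -scalerAr laplace_scale ?gt_eqF// -mulrA.
Qed.

Lemma psi_psi_core theta0 theta1 n : 0 < theta0 -> 0 < theta1 ->
  let theta := (theta0 + theta1) / 2 in
  psi theta0 theta1 n.+1 = (theta0 * theta1) ^+ n.+1 * expR (- theta0)
    / (2 * theta) ^+ n.+2 * psi_core theta (bessel_poly theta) n.+1.
Proof.
move=> h0 h1 theta; have th0 : 0 < theta by rewrite divr_gt0// addr_gt0.
have c0 : 2 * theta != 0 by rewrite mulf_neq0// gt_eqF.
rewrite psi_laplace//; have -> : theta0 + theta1 = 2 * theta.
  by rewrite /theta; field.
have -> : laplace (2 * theta) ('X^n * ('X + 1) ^+ n.+2) =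
  ((2 * n.+1%:R + 2 * theta) * laplaceXX1 (2 * theta) n.+1
    + n.+1%:R * laplaceXX1 (2 * theta) n) / (2 * n.+1%:R).
  by rewrite -laplace_Xn_XD1n// [RHS]mulrC mulKf// mulf_neq0 ?pnatr_eq0.
have n1 : n.+1%:R != 0 :> R by rewrite pnatr_eq0.
have f0 : n`!%:R != 0 :> R by rewrite pnatr_eq0 -lt0n fact_gt0.
rewrite /psi_core /bessel_poly /= factS natrM ![(2 * theta) ^+ n.+2]exprS.
move: n.+1%:R n1 => N n1; field.
by rewrite f0 n1 expf_neq0//= gt_eqF.
Qed.

Lemma psi_core_besselK theta n : 0 < theta ->
  theta `^ (n.+1%:R - 2^-1)
    / (2 `^ (n.+1%:R + 2^-1) * n.+1`!%:R * Num.sqrt (pi : R)) *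
   ((n.+1%:R + theta) * besselK (n.+1%:R + 2^-1) theta +
    theta * besselK (n.+1%:R - 2^-1) theta)
  = theta ^+ n.+1 * theta ^+ n.+1 * expR (- theta) / (2 * theta) ^+ n.+2
     * psi_core theta (bessel_poly theta) n.+1.
Proof.
move=> h; have [-> ->] := besselK_half n.+1 h (bessel_poly_recurrence h).
rewrite powRB; last by rewrite (gt_eqF h) implybT.
rewrite powRD ?powR_mulrn ?powR12_sqrt ?sqrtrM ?ltW//; last first.
  by rewrite pnatr_eq0 implybT.
have st : Num.sqrt theta != 0 by rewrite gt_eqF// sqrtr_gt0.
have s2 : Num.sqrt 2 != 0 :> R by rewrite gt_eqF// sqrtr_gt0.
have sp : Num.sqrt pi != 0 :> R by rewrite gt_eqF// sqrtr_gt0 pi_gt0.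
have key : 2 * theta = (Num.sqrt 2 * Num.sqrt theta) ^+ 2.
  by rewrite exprMn !sqr_sqrtr// ltW.
have f0 : n.+1`!%:R != 0 :> R by rewrite pnatr_eq0 -lt0n fact_gt0.
have t1 : theta ^+ n.+1 != 0 by rewrite expf_neq0// gt_eqF.
have t2 : 2 ^+ n.+1 != 0 :> R by rewrite expf_neq0.
rewrite /psi_core /= [(2 * theta) ^+ n.+2]exprS exprMn key.
by field; rewrite f0 t1 t2 st s2.
Qed.

Lemma psi_log_concave theta0 theta1 : 0 < theta0 -> 0 < theta1 ->
  strictly_log_concave (psi theta0 theta1).
Proof.
move=> h0 h1; set theta := (theta0 + theta1) / 2.
have th0 : 0 < theta by rewrite divr_gt0// addr_gt0.
have yrec := bessel_poly_recurrence th0.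
have c0 : 0 < 2 * theta by rewrite mulr_gt0.
split => [[//|n] _|[//|[//|n]] _].
  rewrite psi_psi_core// -/theta mulr_gt0 ?psi_core_gt0// divr_gt0 ?exprn_gt0//.
  by rewrite mulr_gt0 ?expR_gt0// exprn_gt0// mulr_gt0.
rewrite /= !psi_psi_core// -/theta.
have lc := psi_core_log_concave n th0 yrec.
rewrite [ltRHS]exprMn.
set B := theta0 * theta1; have B0 : 0 < B by rewrite mulr_gt0.
set q := 2 * theta in c0 *.
set f := psi_core theta (bessel_poly theta) in lc *.
(* the geometric factors on both sides agree *)
rewrite (_ : B ^+ n.+1 * expR (- theta0) / q ^+ n.+2 * f n.+1 *
   (B ^+ n.+3 * expR (- theta0) / q ^+ n.+4 * f n.+3) =
   (B ^+ n.+2 * expR (- theta0) / q ^+ n.+3) ^+ 2 * (f n.+1 * f n.+3)).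
  rewrite ltr_pM2l// exprn_gt0// divr_gt0 ?exprn_gt0//.
  by rewrite mulr_gt0 ?expR_gt0// exprn_gt0.
have q1 : q ^+ n.+2 != 0 by rewrite expf_neq0// gt_eqF.
rewrite [B ^+ n.+3]exprS [B ^+ n.+2]exprS [q ^+ n.+4]exprS [q ^+ n.+3]exprS.
move: (q ^+ n.+2) q1 (B ^+ n.+1) => r r0 b; field.
by rewrite r0 gt_eqF.
Qed.

End Psi.

Unset Implicit Arguments.

Theorem theorem5 (R : realType) :
  (forall (theta : R) (n : nat), 0 < theta -> (1 <= n)%N ->
     psi theta theta n =
       theta `^ (n%:R - 2^-1) /
         (2 `^ (n%:R + 2^-1) * n`!%:R * Num.sqrt (pi : R)) *
       ((n%:R + theta) * besselK (n%:R + 2^-1) theta +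
        theta * besselK (n%:R - 2^-1) theta) /\
     (forall theta0 theta1 : R, 0 < theta0 -> 0 < theta1 ->
        (theta0 + theta1) / 2 = theta ->
        psi theta0 theta1 n =
          expR (theta - theta0) * psi theta theta n *
          (theta0 * theta1 / theta ^+ 2) ^+ n)) /\
  (forall theta0 theta1 : R, 0 < theta0 -> 0 < theta1 ->
     strictly_log_concave (psi theta0 theta1)).
Proof.
split; last exact: psi_log_concave.
move=> theta [//|n] th0 _.
have E : psi theta theta n.+1 = theta ^+ n.+1 * theta ^+ n.+1 * expR (- theta)
    / (2 * theta) ^+ n.+2 * psi_core theta (bessel_poly theta) n.+1.
  by rewrite psi_psi_core// (_ : (theta + theta) / 2 = theta) ?exprMn//; field.
split; first by rewrite psi_core_besselK.
move=> theta0 theta1 h0 h1 th; rewrite E psi_psi_core// th.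
have -> : expR (- theta0) = expR (theta - theta0) * expR (- theta).
  by rewrite -expRD; congr expR; ring.
have t1 : theta ^+ n.+1 != 0 by rewrite expf_neq0// gt_eqF.
have t2 : (2 * theta) ^+ n.+2 != 0 by rewrite expf_neq0// mulf_neq0 ?gt_eqF.
rewrite expr_div_n [theta ^+ 2]expr2 (exprMn _ theta theta); field.
by rewrite t2 t1.
Qed.
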